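(* Let $G$ be a group of nilpotency class $n$. Then the nilpotency class of the non-abelian tensor square $G\otimes G$ is bounded above by $\lceil n/2\rceil$, where $\lceil x\rceil$ denotes the ceiling function.
   Context: Write ${}^{g}g'=gg'g^{-1}$. The non-abelian tensor square $G\otimes G$ (all actions being conjugation) is the group generated by symbols $g\otimes h$ ($g,h\in G$) with relations $gg'\otimes h=({}^{g}g'\otimes {}^{g}h)(g\otimes h)$ and $g\otimes hh'=(g\otimes h)({}^{h}g\otimes {}^{h}h')$ for all $g,g',h,h'\in G$. *)

(* Defs.v *)
From HB Require Import structures.
From mathcomp Require Import all_boot.
From mathcomp Require Import boolp classical_sets.

Set Implicit Arguments.
Unset Strict Implicit.
Unset Printing Implicit Defensive.

Local Open Scope quotient_scope.
Local Open Scope classical_set_scope.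
Local Open Scope group_scope.

Section Presentation.
Variable X : choiceType.

(* The letter (x, false) stands for the generator x and (x, true) for its
   formal inverse. *)
Definition word := seq (X * bool).

Definition flip (a : X * bool) : X * bool := (a.1, ~~ a.2).

Definition inv_word (u : word) : word := rev (map flip u).

Variable R : word -> word -> Prop.

Inductive pres_eq : word -> word -> Prop :=
| pres_refl u : pres_eq u u
| pres_sym u v : pres_eq u v -> pres_eq v u
| pres_trans v u w : pres_eq u v -> pres_eq v w -> pres_eq u w
| pres_cat u u' v v' : pres_eq u u' -> pres_eq v v' -> pres_eq (u ++ v) (u' ++ v')
| pres_cancel a : pres_eq [:: a; flip a] [::]
| pres_rel u v : R u v -> pres_eq u v.

Definition pres_eqb : rel word := fun u v => `[< pres_eq u v >].

Lemma pres_eqb_refl : reflexive pres_eqb.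
Proof. by move=> u; apply/asboolP; exact: pres_refl. Qed.

Lemma pres_eqb_sym : symmetric pres_eqb.
Proof. by move=> u v; apply/asboolP/asboolP; exact: pres_sym. Qed.

Lemma pres_eqb_trans : transitive pres_eqb.
Proof.
move=> v u w /asboolP uv /asboolP vw; apply/asboolP; exact: pres_trans uv vw.
Qed.

Canonical pres_equiv := EquivRel pres_eqb pres_eqb_refl pres_eqb_sym pres_eqb_trans.

(* The group < X | u = v for R u v >. *)
Definition pres_group := {eq_quot pres_equiv}.
HB.instance Definition _ := Choice.on pres_group.

Definition pres_class (u : word) : pres_group := \pi_({eq_quot pres_equiv}) u.
Definition pres_repr (x : pres_group) : word := repr x.

Lemma pres_reprK x : pres_class (pres_repr x) = x.
Proof. exact: reprK. Qed.

Lemma pres_classP u v : pres_class u = pres_class v <-> pres_eq u v.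
Proof. by split=> [/eqmodP/asboolP|uv]; last exact/eqmodP/asboolP. Qed.

Lemma repr_pres_class u : pres_eq (pres_repr (pres_class u)) u.
Proof. by apply/pres_classP; rewrite pres_reprK. Qed.

Lemma flipK : involutive flip.
Proof. by case=> x b; rewrite /flip /= negbK. Qed.

Lemma inv_word_cat u v : inv_word (u ++ v) = inv_word v ++ inv_word u.
Proof. by rewrite /inv_word map_cat rev_cat. Qed.

Lemma inv_wordK : involutive inv_word.
Proof. by move=> u; rewrite /inv_word map_rev revK (mapK flipK). Qed.

Lemma pres_cat_inv u : pres_eq (u ++ inv_word u) [::].
Proof.
elim: u => [|a u IHu]; first exact: pres_refl.
rewrite -cat1s inv_word_cat -catA.
apply: pres_trans (pres_cancel a).
rewrite -[[:: a; _]]/([:: a] ++ [:: flip a]).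
apply: pres_cat; first exact: pres_refl.
rewrite catA -[X in pres_eq _ X]cat0s.
by apply: pres_cat; last exact: pres_refl.
Qed.

Lemma pres_inv_cat u : pres_eq (inv_word u ++ u) [::].
Proof. by rewrite -{2}[u]inv_wordK; exact: pres_cat_inv. Qed.

Lemma pres_inv u v : pres_eq u v -> pres_eq (inv_word u) (inv_word v).
Proof.
move=> uv; apply: (@pres_trans (inv_word u ++ (v ++ inv_word v))).
  rewrite -[X in pres_eq X _]cats0.
  by apply: pres_cat; [exact: pres_refl | exact/pres_sym/pres_cat_inv].
rewrite catA -[X in pres_eq _ X]cat0s.
apply: pres_cat; last exact: pres_refl.
apply: pres_trans (pres_inv_cat u).
by apply: pres_cat; [exact: pres_refl | exact: pres_sym].
Qed.

Definition pres_mul (x y : pres_group) : pres_group :=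
  pres_class (pres_repr x ++ pres_repr y).
Definition pres_one : pres_group := pres_class [::].
Definition pres_inverse (x : pres_group) : pres_group :=
  pres_class (inv_word (pres_repr x)).

Lemma pres_mulE u v :
  pres_mul (pres_class u) (pres_class v) = pres_class (u ++ v).
Proof. by apply/pres_classP; apply: pres_cat; exact: repr_pres_class. Qed.

Lemma pres_inverseE u : pres_inverse (pres_class u) = pres_class (inv_word u).
Proof. by apply/pres_classP; apply: pres_inv; exact: repr_pres_class. Qed.

Lemma pres_mulA : associative pres_mul.
Proof.
move=> x y z; rewrite -[x]pres_reprK -[y]pres_reprK -[z]pres_reprK.
by rewrite !pres_mulE catA.
Qed.

Lemma pres_mul1 : left_id pres_one pres_mul.
Proof. by move=> x; rewrite -[x]pres_reprK pres_mulE. Qed.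

Lemma pres_mulr1 : right_id pres_one pres_mul.
Proof. by move=> x; rewrite -[x]pres_reprK pres_mulE cats0. Qed.

Lemma pres_mulV : left_inverse pres_one pres_inverse pres_mul.
Proof.
move=> x; rewrite -[x]pres_reprK pres_inverseE pres_mulE.
exact/pres_classP/pres_inv_cat.
Qed.

Lemma pres_mulrV : right_inverse pres_one pres_inverse pres_mul.
Proof.
move=> x; rewrite -[x]pres_reprK pres_inverseE pres_mulE.
exact/pres_classP/pres_cat_inv.
Qed.

HB.instance Definition _ := isMonoid.Build pres_group pres_mulA pres_mul1 pres_mulr1.
HB.instance Definition _ := hasInv.Build pres_group pres_inverse.
HB.instance Definition _ := Monoid_isGroup.Build pres_group pres_mulV pres_mulrV.

Lemma pres_class_cat u v : pres_class (u ++ v) = pres_class u * pres_class v.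
Proof. by rewrite -pres_mulE. Qed.

Lemma pres_class_inv u : pres_class (inv_word u) = (pres_class u)^-1.
Proof. by rewrite -pres_inverseE. Qed.

Section Lift.
Variables (H : groupType) (f : X -> H).

Definition word_eval (u : word) : H :=
  \prod_(a <- u) (if a.2 then (f a.1)^-1 else f a.1).

Hypothesis f_rel : forall u v, R u v -> word_eval u = word_eval v.

Definition pres_lift (x : pres_group) : H := word_eval (pres_repr x).

Lemma word_eval_pres_eq u v : pres_eq u v -> word_eval u = word_eval v.
Proof.
elim=> {u v} [//|u v _ -> //|v u w _ -> //|u u' v v' _ uu' _ vv'|[x b]|//].
  by rewrite /word_eval !big_cat -!/(word_eval _) uu' vv'.
rewrite /word_eval !big_cons big_nil mulg1 /=.
by case: b; rewrite /= ?mulgV ?mulVg.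
Qed.

Lemma pres_lift_class u : pres_lift (pres_class u) = word_eval u.
Proof. exact/word_eval_pres_eq/repr_pres_class. Qed.

Lemma pres_liftM : {morph pres_lift : x y / x * y}.
Proof.
move=> x y; rewrite -[x]pres_reprK -[y]pres_reprK -pres_class_cat.
by rewrite !pres_lift_class /word_eval big_cat.
Qed.

End Lift.

End Presentation.

Section TensorSquare.
Variable G : groupType.

(* The left conjugate g x g^-1; the library's x ^ g is g^-1 x g. *)
Definition lconj (g x : G) : G := g * x * g^-1.

Definition tensor_word (g h : G) : word (G * G)%type := [:: ((g, h), false)].

Variant tensor_rel : word (G * G)%type -> word (G * G)%type -> Prop :=
| TensorMl g g' h : tensor_rel (tensor_word (g * g') h)
    (tensor_word (lconj g g') (lconj g h) ++ tensor_word g h)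
| TensorMr g h h' : tensor_rel (tensor_word g (h * h'))
    (tensor_word g h ++ tensor_word (lconj h g) (lconj h h')).

Definition tensor_square : groupType := pres_group tensor_rel.

Definition tensor (g h : G) : tensor_square :=
  pres_class tensor_rel (tensor_word g h).

Lemma tensorMl g g' h :
  tensor (g * g') h = tensor (lconj g g') (lconj g h) * tensor g h.
Proof. by rewrite /tensor -pres_class_cat; apply/pres_classP/pres_rel; constructor. Qed.

Lemma tensorMr g h h' :
  tensor g (h * h') = tensor g h * tensor (lconj h g) (lconj h h').
Proof. by rewrite /tensor -pres_class_cat; apply/pres_classP/pres_rel; constructor. Qed.

Lemma tensor_lift (H : groupType) (f : G -> G -> H) :
    (forall g g' h, f (g * g') h = f (lconj g g') (lconj g h) * f g h) ->
    (forall g h h', f g (h * h') = f g h * f (lconj h g) (lconj h h')) ->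
  exists2 F : tensor_square -> H, {morph F : x y / x * y} &
    forall g h, F (tensor g h) = f g h.
Proof.
move=> fMl fMr; pose f2 (p : G * G) := f p.1 p.2.
have f_rel u v : tensor_rel u v -> word_eval f2 u = word_eval f2 v.
  by case=> [g g' h|g h h']; rewrite /word_eval /tensor_word ?big_cat ?big_seq1;
    [exact: fMl | exact: fMr].
exists (pres_lift f2); first exact: pres_liftM f_rel.
move=> g h; rewrite /tensor (pres_lift_class f_rel).
by rewrite /word_eval big_seq1.
Qed.

End TensorSquare.

Section Nilpotency.
Variable G : groupType.

Definition subgroup (H : set G) : Prop :=
  H 1 /\ forall x y, H x -> H y -> H (x * y^-1).

(* Indexed from 0: lower_central k is usually written gamma_(k+1). *)
Fixpoint lower_central (k : nat) : set G :=
  if k is k'.+1 then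
    smallest subgroup [set [~ x, y] | x in lower_central k' & y in setT]
  else setT.

Definition has_nilpotency_class (n : nat) : Prop :=
  lower_central n = [set 1] /\
  forall m, lower_central m = [set 1] -> (n <= m)%N.

End Nilpotency.
Arguments has_nilpotency_class : clear implicits.

(* Main.v *)
Require Import Defs.
From HB Require Import structures.
From mathcomp Require Import all_boot.
From mathcomp Require Import boolp classical_sets.

(** The map kappa : g (x) h |-> g h g^-1 h^-1 extends to a homomorphism from
the tensor square of G to G, and G acts on the tensor square by conjugating
both factors of each g (x) h. The point of the proof is that [x] acts on the
tensor square by conjugation exactly as kappa x does through this action
([conj_tensor_square]); for generators, this comes from expanding
gg' (x) hh' in the two possible orders ([tensor_interchange]). Hence, if
kappa x is central in G, then [x] is central in the tensor square
([central_of_commutator_central]).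

The image of kappa lies in the derived subgroup of G, and commuting with an
element of the derived subgroup goes down two steps in the lower central
series ([lower_central_comm_derived], from the Hall-Witt identity). With
terms numbered as gamma_1 = G, kappa therefore maps gamma_k of the tensor
square into gamma_(2k) of G ([commutator_lower_central]). Let G have class
n > 0 and let k be the ceiling of n / 2. As 2k >= n, gamma_(2k) of G is
central, so gamma_k of the tensor square is central and gamma_(k+1) of it is
trivial. Using centrality, rather than only the centrality of the kernel of
kappa, is what saves one step when n is even. *)

Local Open Scope classical_set_scope.
Local Open Scope group_scope.

(** * The lower central series *)

Section SubgroupClosure.
Variables (G : groupType) (H : set G).
Hypothesis sgH : subgroup H.

Lemma subgroupV x : H x -> H x^-1.
Proof. by move=> Hx; rewrite -[x^-1]mul1g; apply: sgH.2 => //; exact: sgH.1. Qed.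

Lemma subgroupM x y : H x -> H y -> H (x * y).
Proof. by move=> Hx Hy; rewrite -[y]invgK; apply: sgH.2 => //; exact: subgroupV. Qed.

End SubgroupClosure.

Section LowerCentral.
Variable G : groupType.
Implicit Types (x y z g h : G) (k m n : nat).

Lemma lower_central_subgroup k : subgroup (lower_central (G := G) k).
Proof.
case: k => [|k] /=; first by split.
by split=> [A [[]]|x y Hx Hy A [sA cA]] //; apply: sA.2; [exact: Hx|exact: Hy].
Qed.

Lemma lower_central_comm {k x} y : lower_central k x -> lower_central k.+1 [~ x, y].
Proof. by move=> Hx; apply: sub_gen_smallest; exists x => //; exists y. Qed.

Lemma lower_central_decr k : lower_central (G := G) k.+1 `<=` lower_central k.
Proof.
elim: k => [|k IHk] //.
apply: smallest_sub; first exact: lower_central_subgroup.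
by move=> _ [x /IHk Hx [y _ <-]]; exact: lower_central_comm.
Qed.

Lemma lower_central_anti k m :
  (k <= m)%N -> lower_central (G := G) m `<=` lower_central k.
Proof.
move/subnK <-; elim: (m - k)%N => [|d IHd] //.
exact: subset_trans (@lower_central_decr _) IHd.
Qed.

(** Normality needs no induction: x ^ g is x * [~ x, g], and the series is
decreasing. *)
Lemma lower_central_conj k x g : lower_central k x -> lower_central k (x ^ g).
Proof.
move=> Hx; rewrite -[x ^ g](mulVKg x) -commgEl.
apply: subgroupM => //; first exact: lower_central_subgroup.
by apply: lower_central_decr; exact: lower_central_comm.
Qed.

Lemma Hall_Witt x y z :
  [~ x, y^-1, z] ^ y * [~ y, z^-1, x] ^ z * [~ z, x^-1, y] ^ x = 1.
Proof. by rewrite /commg /conjg !gnorm. Qed.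

(** This is the case j = 2 of [gamma_i, gamma_j] <= gamma_(i+j). Elements b with
[~ b, x] in gamma_(i+2) form a subgroup by normality, so b may be taken to be
a commutator [~ g, h]. The Hall-Witt identity then expresses [~ g, h, x]
through two commutators in which x is first bracketed with g or h and then
with the other one. *)
Lemma lower_central_comm_derived k x y :
  lower_central k x -> lower_central 1 y -> lower_central k.+2 [~ y, x].
Proof.
move=> Hx Hy; have sg := lower_central_subgroup k.+2.
suff /(_ y Hy) : lower_central 1 `<=` [set b | lower_central k.+2 [~ b, x]] by [].
move=> {y Hy}; apply: smallest_sub.
  split=> [|b c Hb Hc]; rewrite /mkset; first by rewrite comm1g; exact: sg.1.
  have -> : [~ b * c^-1, x] = ([~ b, x] * [~ c, x]^-1) ^ c^-1.
    by rewrite /commg /conjg !gnorm.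
  by apply: lower_central_conj; exact: sg.2.
move=> _ [g _ [h _ <-]]; rewrite /mkset.
(* The inverse is there because the identity involves [~ g, z^-1, x]. *)
have HW := Hall_Witt x g h^-1; rewrite invgK in HW.
have {HW} -> : [~ g, h, x] =
    (([~ x, g^-1, h^-1] ^ g)^-1 * ([~ h^-1, x^-1, g] ^ x)^-1) ^ h.
  apply: (@conjg_inj _ h^-1); rewrite conjgK.
  apply: (mulgI ([~ x, g^-1, h^-1] ^ g)); rewrite mulVKg.
  by apply: (mulIg ([~ h^-1, x^-1, g] ^ x)); rewrite mulVg.
apply: lower_central_conj; apply: (subgroupM _ _ sg);
  apply: (subgroupV _ _ sg); apply: lower_central_conj.
  by do 2!apply: lower_central_comm.
apply: lower_central_comm; rewrite -invgR.
apply: (subgroupV _ _ (lower_central_subgroup k.+1)); apply: lower_central_comm.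
exact: (subgroupV _ _ (lower_central_subgroup k)).
Qed.

Lemma lower_central1S k :
  (forall x y, lower_central k x -> commute x y) -> lower_central k.+1 = [set (1 : G)].
Proof.
move=> cGk; apply/seteqP; split; last first.
  by move=> _ ->; exact: (lower_central_subgroup _).1.
apply: smallest_sub; first by split=> // _ _ -> ->; rewrite mulgV.
by move=> _ [x Hx [y _ <-]]; apply/eqP/commgP/cGk.
Qed.

Lemma nilpotency_class_le m : lower_central m = [set (1 : G)] ->
  exists2 c, has_nilpotency_class G c & (c <= m)%N.
Proof.
move=> Gm.
have exG : exists k, `[< lower_central k = [set (1 : G)] >] by exists m; exact/asboolP.
case: (ex_minnP exG) => c /asboolP Gc minc.
by exists c; [split=> // k Gk | ]; apply: minc; exact/asboolP.
Qed.

End LowerCentral.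

(** * The commutator map on the tensor square *)

Section TensorSquareTheory.
Variable G : groupType.
Implicit Types (g h : G) (x y : tensor_square G).

Lemma tensor_square_ind (P : tensor_square G -> Prop) :
    P 1 -> (forall x y, P x -> P y -> P (x * y)) -> (forall x, P x -> P x^-1) ->
    (forall g h, P (tensor g h)) -> forall x, P x.
Proof.
move=> P1 PM PV Pt x; rewrite -[x]pres_reprK.
elim: (pres_repr x) => [|[[g h] b] u IHu]; first exact: P1.
rewrite -cat1s pres_class_cat; apply: PM => //.
case: b; last exact: Pt.
by rewrite -[[:: _]]/(inv_word (tensor_word g h)) pres_class_inv; exact/PV/Pt.
Qed.

Lemma lconj_conjg g h : lconj g h = h ^ g^-1.
Proof. by rewrite /lconj /conjg invgK mulgA. Qed.

(** Both sides are the middle part of an expansion of g g' (x) h h': the left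
one splits the first factor before the second, the right one the second before
the first. The outer parts of the two expansions agree and cancel. *)
Lemma tensor_interchange g g' h h' :
  tensor (lconj (g * h) g') (lconj (g * h) h') * tensor g h =
  tensor g h * tensor (lconj (h * g) g') (lconj (h * g) h').
Proof.
have lconjMr a b c : lconj a (b * c) = lconj a b * lconj a c :> G.
  by rewrite !lconj_conjg conjMg.
have lconjM a b c : lconj a (lconj b c) = lconj (a * b) c :> G.
  by rewrite !lconj_conjg invgM conjgM.
(* Each expansion produces the conjugating element in this shape. *)
have -> : g * h = lconj g h * g by rewrite /lconj mulgVK.
have -> : h * g = lconj h g * h by rewrite /lconj mulgVK.
rewrite -!(lconjM (lconj g h) g) -!(lconjM (lconj h g) h).
apply: (mulgI (tensor (lconj g g') (lconj g h))).
apply: (mulIg (tensor (lconj h g) (lconj h h'))).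
transitivity (tensor (g * g') (h * h')).
  rewrite (tensorMl g) lconjMr (tensorMr _ (lconj g h)) (tensorMr g h).
  by rewrite !mulgA.
rewrite (tensorMr _ h) (tensorMl g) lconjMr (tensorMl (lconj h g)).
by rewrite !mulgA.
Qed.

(** [tensor_interchange] for the conjugates of a and b that turn the right-hand
tensor into a (x) b. As [~ x, y] stands for x^-1 y^-1 x y, the commutator
g h g^-1 h^-1 is [~ g^-1, h^-1]. *)
Lemma conj_tensor g h a b :
  tensor a b ^ (tensor g h)^-1 =
  tensor (a ^ [~ g^-1, h^-1]^-1) (b ^ [~ g^-1, h^-1]^-1).
Proof.
rewrite [LHS]conjgE invgK mulgA; apply/eqP; rewrite divg_eq; apply/eqP.
have := tensor_interchange g (a ^ (h * g)) h (b ^ (h * g)).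
rewrite !lconj_conjg -!conjgM !mulgV !conjg1 => <-.
by congr (tensor (_ ^ _) (_ ^ _) * _); rewrite /commg /conjg !gnorm.
Qed.

(** The defining relations of the tensor square are the identities that expand
commutators of products. *)
Lemma tensor_commutator : exists2 kappa : tensor_square G -> G,
  {morph kappa : x y / x * y} &
  forall g h, kappa (tensor g h) = [~ g^-1, h^-1].
Proof.
by apply: tensor_lift => *; rewrite /lconj /commg /conjg !gnorm.
Qed.

Section Commutator.
Variable kappa : tensor_square G -> G.
Hypothesis kappaM : {morph kappa : x y / x * y}.
Hypothesis kappa_tensor : forall g h, kappa (tensor g h) = [~ g^-1, h^-1].

Let kappa1 : kappa 1 = 1.
Proof. by apply: (mulgI (kappa 1)); rewrite -kappaM !mulg1. Qed.

Let kappaV x : kappa x^-1 = (kappa x)^-1.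
Proof. by apply: (mulgI (kappa x)); rewrite -kappaM !mulgV kappa1. Qed.

(** Both sides are right actions of [x], so the formula propagates from the
generators to products and inverses. *)
Lemma conj_tensor_square x a b :
  tensor a b ^ x = tensor (a ^ kappa x) (b ^ kappa x).
Proof.
elim/tensor_square_ind: x a b => [|x y IHx IHy|x IHx|g h] a b.
- by rewrite kappa1 !conjg1.
- by rewrite kappaM !conjgM IHx IHy.
- by apply: (@conjg_inj _ x); rewrite conjgKV IHx kappaV !conjgKV.
rewrite kappa_tensor; apply: (@conjg_inj _ (tensor g h)^-1).
by rewrite conjgK conj_tensor !conjgK.
Qed.

Lemma central_of_commutator_central x y : (forall g, commute g (kappa x)) -> commute x y.
Proof.
move=> cx; apply: commute_sym; elim/tensor_square_ind: y => [|y z|y|g h].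
- exact/commute_sym/commute1.
- by move=> /commute_sym cy /commute_sym cz; exact/commute_sym/commuteM.
- by move/commute_sym/commuteV/commute_sym.
apply/commgP/conjg_fixP; rewrite conj_tensor_square.
by congr tensor; apply/conjg_fixP/commgP.
Qed.

Lemma commutator_derived x : lower_central 1 (kappa x).
Proof.
have sg := lower_central_subgroup G 1.
elim/tensor_square_ind: x => [|x y Hx Hy|x Hx|g h].
- by rewrite kappa1; exact: sg.1.
- by rewrite kappaM; exact: (subgroupM _ _ sg).
- by rewrite kappaV; exact: (subgroupV _ _ sg).
by rewrite kappa_tensor; exact: lower_central_comm.
Qed.

Lemma commutator_lower_central k x :
  lower_central k x -> lower_central k.*2.+1 (kappa x).
Proof.
elim: k x => [|k IHk] x; first by move=> _; exact: commutator_derived.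
have sg := lower_central_subgroup G k.+1.*2.+1.
move: x; apply: smallest_sub => [|_ [x /IHk Hx [y _ <-]]].
  split=> [|x y Hx Hy]; rewrite /mkset; first by rewrite kappa1; exact: sg.1.
  by rewrite kappaM kappaV; exact: sg.2.
(* The derived element kappa y belongs on the left of the bracket. *)
rewrite /mkset /commg /conjg !(kappaM, kappaV) -/(conjg _ _) -/(commg _ _) -invgR.
apply: (subgroupV _ _ sg); rewrite doubleS.
exact: lower_central_comm_derived (commutator_derived y).
Qed.

End Commutator.

(** The hypothesis makes the preceding term of the series of G central, and
that term contains the image of [lower_central k] under the commutator map. *)
Lemma tensor_square_lower_central k :
  lower_central k.+1.*2 = [set (1 : G)] ->
  lower_central k.+1 = [set (1 : tensor_square G)].
Proof.
move=> Gk; have [kappa kM kt] := tensor_commutator.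
apply: lower_central1S => x y Hx; apply: (central_of_commutator_central _ kM kt) => g.
apply/commute_sym/commgP/eqP.
have := lower_central_comm _ g (commutator_lower_central _ kM kt k x Hx).
by rewrite -doubleS Gk.
Qed.

(** This covers class 0, where gamma_k with k = 0 does not exist and the general
bound does not apply. *)
Lemma tensor_square_trivial : (forall g, g = 1) -> forall x, x = 1.
Proof.
move=> G1; apply: tensor_square_ind => [//|x y -> ->|x ->|g h].
- by rewrite mulg1.
- by rewrite invg1.
apply: (mulgI (tensor g h)); rewrite mulg1 [RHS](_ : _ = tensor (g * g) h).
  by rewrite tensorMl; congr (tensor _ _ * _); rewrite [LHS]G1 [RHS]G1.
by congr tensor; rewrite [LHS]G1 [RHS]G1.
Qed.

End TensorSquareTheory.

(* uphalf n = n.+1./2 is the ceiling of n / 2. *)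
Theorem corollary3p3 (G : groupType) (n : nat)
    (hG : has_nilpotency_class G n) :
  exists2 c : nat, has_nilpotency_class (tensor_square G) c & (c <= uphalf n)%N.
Proof.
case: hG => Gn _; apply: nilpotency_class_le.
case: n => [|n] in Gn *.
  apply/seteqP; split=> // x _; apply: tensor_square_trivial => g.
  by have : lower_central 0 g by []; rewrite Gn.
rewrite [uphalf n.+1]/=; apply: tensor_square_lower_central.
apply/seteqP; split=> [|_ ->]; last exact: (lower_central_subgroup _ _).1.
rewrite -Gn; apply: lower_central_anti.
by rewrite doubleS -{1}[n]odd_double_half; case: (odd n).
Qed.
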